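(* Assume the explicit $abc$-conjecture of Baker. Then there are no positive integers $n_1<n_2$ such that for $i=0,1,2$ the numbers $n_1+i$ and $n_2+i$ have the same prime divisors (i.e. for each $i=0,1,2$ exactly the same set of primes divides $n_1+i$ and $n_2+i$).
   Context: For a positive integer $x$, $R(x)$ denotes the greatest squarefree factor (radical) of $x$, i.e. the product of the distinct primes dividing $x$, with $R(1)=1$, and $\omega(x)$ denotes the number of distinct prime factors of $x$, with $\omega(1)=0$. The explicit $abc$-conjecture (Baker) is the statement: let $a,b$ and $c$ be pairwise coprime positive integers satisfying $a+b=c$. Then $$c<\frac65\,R(abc)\,\frac{(\log R(abc))^{\omega(abc)}}{\omega(abc)!}.$$
   Formalization: The explicit abc-conjecture as printed fails for a = b = 1, c = 2 (the bound is (12/5) log 2 < 2), so it is assumed here for all triples except that one; this weaker assumption makes the theorem stronger than the literal one. *)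

(* Defs.v *)
From HB Require Import structures.
From mathcomp Require Import all_boot all_order all_algebra.
From mathcomp Require Import all_classical all_reals all_analysis.
From mathcomp Require Import lra.

Set Implicit Arguments.
Unset Strict Implicit.
Unset Printing Implicit Defensive.

Import Order.TTheory GRing.Theory Num.Theory.

Local Open Scope ring_scope.

Definition radical (x : nat) : nat := (\prod_(p <- primes x) p)%N.

Definition omega (x : nat) : nat := size (primes x).

Section Abc.
Variable R : realType.

Definition abc_bound (a b c : nat) : Prop :=
  let r : R := (radical (a * b * c))%:R in
  let w := omega (a * b * c) in
  c%:R < 6 / 5 * r * (ln r ^+ w / (w`!)%:R).

Definition abc_triple (a b c : nat) : Prop :=
  [/\ (0 < a)%N, (0 < b)%N & (0 < c)%N] /\
  [/\ coprime a b, coprime a c & coprime b c] /\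
  (a + b)%N = c.

(* The wording "for all pairwise coprime positive a + b = c" includes the
   degenerate triple 1 + 1 = 2, whose bound (12/5) ln 2 = 1.66... is less
   than 2 ([abc_bound_112] below), so read literally the conjecture is
   refutable and anything follows from it.  That one triple is left out here.
   This only weakens the conjecture ([explicit_abc_of_literal]), so a theorem
   assuming [explicit_abc] also holds under the literal wording. *)
Definition explicit_abc : Prop :=
  forall a b c : nat,
    abc_triple a b c -> (a, b, c) <> (1, 1, 2)%N -> abc_bound a b c.

Definition explicit_abc_literal : Prop :=
  forall a b c : nat, abc_triple a b c -> abc_bound a b c.

Lemma explicit_abc_of_literal : explicit_abc_literal -> explicit_abc.
Proof. by move=> abc a b c abcT _; exact: abc. Qed.

Lemma abc_bound_112 : ~ abc_bound 1 1 2.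
Proof.
have ln2 : ln (2 : R) <= 5 / 6.
  rewrite -[leRHS]expRK ler_ln ?posrE ?expR_gt0 //.
  have -> : 5 / 6 = 5 / 12 + 5 / 12 :> R by lra.
  have := @expR_ge1Dx R (5 / 12); rewrite expRD.
  move: (expR _) => y y_ge; have {}y_ge : 17 / 12 <= y by lra.
  have := ler_pM _ _ y_ge y_ge; lra.
rewrite /abc_bound /radical /omega !mul1n /= big_cons big_nil muln1 expr1.
by rewrite (_ : 1`! = 1)%N // divr1 /= => h; lra.
Qed.

End Abc.

Definition same_prime_divisors (x y : nat) : Prop :=
  forall p : nat, prime p -> (p %| x)%N <-> (p %| y)%N.

(* Main.v *)
Require Import Defs.
From mathcomp Require Import all_boot all_order all_algebra.
From mathcomp Require Import all_classical all_reals all_analysis.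
From mathcomp Require Import ring lra zify.

(** Write n = n2 and r for the radical of n (n + 1) (n + 2).  A prime dividing
    some n2 + i divides n1 + i as well, hence divides n2 - n1; since r is a
    product of distinct such primes, r divides n2 - n1
    ([radical_dvd_of_prime_dvd]), and so r < n.

    In the other direction, n (n + 2) + 1 = (n + 1)^2 is an abc triple of
    radical r.  With x = log r, the factor x^w / w! in Baker's bound is one
    term of the power series of exp x = r, and for w > 0 a neighbouring term
    is at least half as large, so that 6/5 x^w / w! <= r
    ([exp_term_le_expR]).  The conjecture therefore gives c < r^2 for every
    such triple ([abc_lt_radical_sqr]), here (n + 1)^2 < r^2, that is
    n + 1 < r, a contradiction. *)

Import Order.TTheory GRing.Theory Num.Theory.

Local Open Scope ring_scope.

Lemma exp_coeff_partial_sum_le_expR {R : realType} (x : R) (n : nat) :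
  0 <= x -> \sum_(0 <= i < n) x ^+ i / i`!%:R <= expR x.
Proof.
move=> x_ge0.
have mono : nondecreasing_seq (series (exp_coeff x)).
  by apply: nondecreasing_series => i _ _; exact: exp_coeff_ge0.
exact: (nondecreasing_cvgn_le mono (is_cvg_series_exp_coeff x) n).
Qed.

(** Both neighbours of the [k]-th term of the exponential series are terms of
    the sum as well.  The preceding one is [k / x] times the [k]-th, hence at
    least as large when [x <= k]; the following one is [x / k.+1] times the
    [k]-th, hence at least half as large when [x > k].  The constant term has
    no predecessor, and the bound fails for [k = 0] and [x] near 0. *)
Lemma exp_term_le_expR {R : realType} (x : R) (k : nat) :
  0 <= x -> (0 < k)%N -> 6 / 5 * (x ^+ k / k`!%:R) <= expR x.
Proof.
case: k => // k x_ge0 _.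
apply: le_trans (exp_coeff_partial_sum_le_expR x k.+3 x_ge0).
rewrite !big_nat_recr //= !factS !natrM !exprS.
have sum_ge0 : 0 <= \sum_(0 <= i < k) x ^+ i / i`!%:R.
  by apply: sumr_ge0 => i _; rewrite divr_ge0 // exprn_ge0.
have fk_neq0 : k`!%:R != 0 :> R by rewrite pnatr_eq0 -lt0n fact_gt0.
have k1_gt0 : 0 < k.+1%:R :> R by rewrite ltr0n.
have k2_gt0 : 0 < k.+2%:R :> R by rewrite ltr0n.
set S := \sum_(_ <= _ < _) _ in sum_ge0 *.
(* [t] is the predecessor; the other two terms are [t u] and [t u v]. *)
pose t := x ^+ k / k`!%:R; pose u := x / k.+1%:R; pose v := x / k.+2%:R.
have t_ge0 : 0 <= t by rewrite divr_ge0 // exprn_ge0.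
have u_ge0 : 0 <= u by rewrite divr_ge0 // ltW.
have v_ge0 : 0 <= v by rewrite divr_ge0 // ltW.
have -> : x * x ^+ k / (k.+1%:R * k`!%:R) = t * u.
  by rewrite /t /u; field; rewrite fk_neq0 gt_eqF.
have -> : x * (x * x ^+ k) / (k.+2%:R * (k.+1%:R * k`!%:R)) = t * (u * v).
  by rewrite /t /u /v; field; rewrite fk_neq0 !gt_eqF.
rewrite -/t.
suff : 6 / 5 * u <= 1 + u + u * v.
  by move=> /(ler_wpM2l t_ge0); lra.
have [u_le1|u_gt1] := leP u 1; first by have := mulr_ge0 u_ge0 v_ge0; lra.
have v_ge : 1 / 2 <= v.
  have x_gt : k.+1%:R < x by move: u_gt1; rewrite ltr_pdivlMr // mul1r.
  rewrite ler_pdivlMr //; move: x_gt; rewrite -(natr1 k.+1) -natr1.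
  by have := ler0n R k; lra.
by have := ler_wpM2l u_ge0 v_ge; lra.
Qed.

Lemma radical_gt0 (x : nat) : (0 < radical x)%N.
Proof.
rewrite /radical big_seq prodn_cond_gt0 // => p.
by rewrite mem_primes => /andP[/prime_gt0].
Qed.

(** Distinct primes are pairwise coprime, so a number divisible by each of
    them is divisible by their product. *)
Lemma radical_dvd_of_prime_dvd (m d : nat) : (0 < m)%N ->
  (forall p, prime p -> p %| m -> p %| d)%N -> (radical m %| d)%N.
Proof.
move=> m_gt0 dvd_d; rewrite /radical.
have : all (fun p => prime p && (p %| d)%N) (primes m).
  apply/allP => p; rewrite mem_primes => /and3P[p_pr _ p_m].
  by rewrite p_pr dvd_d.
elim: (primes m) (primes_uniq m) => [|p s IHs] /=.
  by rewrite big_nil dvd1n.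
move=> /andP[p_s s_uniq] /andP[/andP[p_pr p_d] s_all].
rewrite big_cons Gauss_dvd ?p_d ?IHs // big_seq.
apply: (big_ind (fun q => coprime p q)) => [|a b|q q_s].
- exact: coprimen1.
- by rewrite coprimeMr => -> ->.
- have /andP[q_pr _] := allP s_all q q_s.
  rewrite prime_coprime // dvdn_prime2 //.
  by apply: contra p_s => /eqP ->.
Qed.

(** Since [exp (ln r) = r], the quantity multiplying [6 / 5 * r] in Baker's bound is a
    term of the exponential series whose sum is [r]; it is not the constant
    term, because [a * b * c] has a prime divisor. *)
Lemma abc_lt_radical_sqr {R : realType} (a b c : nat) :
  (1 < a * b * c)%N -> abc_bound R a b c ->
  (c < radical (a * b * c) ^ 2)%N.
Proof.
rewrite /abc_bound; set m := (a * b * c)%N => m_gt1 c_lt.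
have r_gt0 := radical_gt0 m.
have rR_gt0 : 0 < (radical m)%:R :> R by rewrite ltr0n.
have w_gt0 : (0 < omega m)%N.
  have : pdiv m \in primes m.
    by rewrite mem_primes pdiv_prime // pdiv_dvd ltnW.
  by rewrite /omega; case: (primes m).
have ln_ge0 : 0 <= ln (radical m)%:R :> R by rewrite ln_ge0 // ler1n.
have := @exp_term_le_expR R _ _ ln_ge0 w_gt0.
rewrite lnK ?posrE // => term_le.
rewrite -(ltr_nat R) natrX; apply: lt_le_trans c_lt _.
by have := ler_wpM2l (ltW rR_gt0) term_le; rewrite expr2; lra.
Qed.

Theorem theorem9p1 (R : realType) (Habc : explicit_abc R) :
  ~ exists n1 n2 : nat,
      [/\ (0 < n1)%N, (n1 < n2)%N &
          forall i : nat, (i <= 2)%N ->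
            same_prime_divisors (n1 + i)%N (n2 + i)%N].
Proof.
move=> [n1 [n]] [n1_gt0 n1_lt same].
pose a := (n * (n + 2))%N; pose c := ((n + 1) ^ 2)%N.
have a_c : (a + 1)%N = c by rewrite /a /c; lia.
have a_gt1 : (1 < a)%N by rewrite /a; nia.
have triple : abc_triple a 1 c.
  split; first by split=> //; lia.
  split; last exact: a_c.
  split; rewrite ?coprimen1 ?coprime1n //.
  by rewrite -a_c addn1 coprimenS.
have bound := Habc a 1 c triple.
have {}bound : abc_bound R a 1 c by apply: bound => -[]; lia.
have m_gt1 : (1 < a * 1 * c)%N by nia.
have := abc_lt_radical_sqr a 1 c m_gt1 bound.
rewrite {1}/c ltn_exp2r // => n_lt_r.
have dvd_diff i p : (i <= 2)%N -> prime p -> (p %| n + i)%N -> (p %| n - n1)%N.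
  move=> i_le2 p_pr p_n; rewrite -(subnDr i) dvdn_sub //.
  by apply/(same i i_le2 p p_pr).
have r_dvd : (radical (a * 1 * c) %| n - n1)%N.
  apply: radical_dvd_of_prime_dvd => [|p p_pr]; first exact: ltnW.
  rewrite muln1 /a /c Euclid_dvdM // Euclid_dvdM // Euclid_dvdX // andbT.
  move=> /orP[/orP[p_n|p_n]|p_n].
  - by apply: (dvd_diff 0); rewrite ?addn0.
  - exact: (dvd_diff 2).
  - exact: (dvd_diff 1).
have := dvdn_leq _ r_dvd; rewrite subn_gt0 => /(_ n1_lt).
by lia.
Qed.
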